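(* Consider ${\rm APP}=\{{\rm APP}_{\infty,d}\}_{d\in\mathbb N}$ in the worst case setting for the absolute or normalized error criterion. Then EXP-UWT for $\Lambda^{\rm all}$ is equivalent to EXP-UWT for $\Lambda^{\rm std}$.
   Context: $\mathbb T^d=[0,1]^d$ is the torus with Lebesgue measure; $\hat f(\mathbf k)=\int f(\mathbf x)e^{-2\pi i\mathbf k\cdot\mathbf x}d\mathbf x$. For each $d$ let $\omega_d:\mathbb Z^d\to(0,\infty)$ with $\sum_{\mathbf k}\omega_d(\mathbf k)^{-2}<\infty$, and $H^{\omega_d}(\mathbb T^d)$ the Hilbert space of $f\in L_2(\mathbb T^d)$ with $\|f\|^2=\sum_{\mathbf k}|\hat f(\mathbf k)|^2\omega_d(\mathbf k)^2<\infty$. ${\rm APP}_{\infty,d}:H^{\omega_d}(\mathbb T^d)\to L_\infty(\mathbb T^d)$ (sup norm), $f\mapsto f$. $\Lambda^{\rm all}$: all continuous linear functionals; $\Lambda^{\rm std}$: point evaluations. $e(n,{\rm APP}_{\infty,d};\Lambda)$: infimum over algorithms $A(f)=\phi(L_1f,\dots,L_nf)$, $L_i\in\Lambda$, $\phi$ arbitrary, of $\sup_{\|f\|\le1}\|f-A(f)\|_\infty$; $e(0,{\rm APP}_{\infty,d})=\sup_{\|f\|\le1}\|f\|_\infty$. $n^\star(\varepsilon,d;\Lambda)=\inf\{n\ge0:e(n,{\rm APP}_{\infty,d};\Lambda)\le\varepsilon{\rm CRI}_d\}$ with ${\rm CRI}_d=1$ (ABS) or $e(0,{\rm APP}_{\infty,d})$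 (NOR). EXP-UWT for $\Lambda$: $\lim_{\varepsilon^{-1}+d\to\infty}\ln n^\star(\varepsilon,d;\Lambda)/((1+\ln\varepsilon^{-1})^\alpha+d^\beta)=0$ for all $\alpha,\beta>0$ ($d\in\mathbb N$, $\varepsilon\in(0,1)$). *)

(* Defs.v *)
From HB Require Import structures.
From mathcomp Require Import all_boot all_order all_algebra.
From mathcomp Require Import all_classical all_reals all_analysis.
From mathcomp.real_closed Require Import complex.

Set Implicit Arguments.
Unset Strict Implicit.
Unset Printing Implicit Defensive.

Import Order.TTheory GRing.Theory Num.Theory.
Local Open Scope classical_set_scope.
Local Open Scope ring_scope.

Section Defs.
Variable R : realType.
Local Notation C := (R[i]).

Definition cabs (z : C) : R := ComplexField.Normc.normc z.

Definition freq (d : nat) := 'rV[int]_d.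
Definition pt (d : nat) := 'I_d -> R.
Definition torus (d : nat) : set (pt d) := [set x | forall i, 0 <= x i <= 1].

Definition kdot d (k : freq d) (x : pt d) : R := \sum_(i < d) (k ord0 i)%:~R * x i.

Definition expk d (k : freq d) (x : pt d) : C :=
  (cos (2 * pi * kdot k x) +i* sin (2 * pi * kdot k x))%C.

Definition has_sum (K : eqType) (F : K -> C) (v : C) : Prop :=
  forall eps : R, 0 < eps -> exists S0 : seq K, forall S : seq K,
    uniq S -> {subset S0 <= S} -> cabs (\sum_(k <- S) F k - v) < eps.

(* An element f of H^{omega_d}(T^d) is represented by its Fourier
   coefficients c = (\hat f(k))_k; its (continuous representative) value at x
   is the Fourier series sum_k \hat f(k) e^{2 pi i k.x}. *)
Definition feval d (c : freq d -> C) (x : pt d) : C :=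
  xget 0 [set v | has_sum (fun k => c k * expk k x) v].

Definition hnorm2 d (om : freq d -> R) (c : freq d -> C) : \bar R :=
  (\esum_(k in [set: freq d]) ((cabs (c k)) ^+ 2 * (om k) ^+ 2)%:E)%E.

Definition inH d (om : freq d -> R) : set (freq d -> C) :=
  [set c | (hnorm2 om c < +oo)%E].

Definition unit_ball d (om : freq d -> R) : set (freq d -> C) :=
  [set c | (hnorm2 om c <= 1)%E].

Definition fnl d := (freq d -> C) -> C.

Definition Lam_all d (om : freq d -> R) : set (fnl d) :=
  [set L | (forall (a : C) c1 c2, inH om c1 -> inH om c2 ->
              L (fun k => a * c1 k + c2 k) = a * L c1 + L c2)
        /\ exists M : R, forall c, inH om c ->
              (((cabs (L c)) ^+ 2)%:E <= (M ^+ 2)%:E * hnorm2 om c)%E].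

Definition Lam_std d : set (fnl d) :=
  [set L | exists2 x : pt d, torus x & L = fun c => feval c x].

Definition box d (a b : pt d) : set (pt d) := [set x | forall i, a i <= x i <= b i].
Definition boxvol d (a b : pt d) : R := \prod_(i < d) Num.max 0 (b i - a i).
Definition null_set d (N : set (pt d)) : Prop :=
  forall eps : R, 0 < eps -> exists a b : nat -> pt d,
    N `<=` \bigcup_n box (a n) (b n) /\
    forall m, \sum_(n < m) boxvol (a n) (b n) <= eps.

Definition ess_sup_T d (h : pt d -> R) : \bar R :=
  ereal_inf [set M : \bar R | null_set [set x | torus x /\ (M < (h x)%:E)%E]].

Definition Linf_dist d (c : freq d -> C) (g : pt d -> C) : \bar R :=
  ess_sup_T (fun x => cabs (feval c x - g x)).

Definition alg_err d (om : freq d -> R) n (L : 'I_n -> fnl d)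
    (phi : ('I_n -> C) -> pt d -> C) : \bar R :=
  ereal_sup [set Linf_dist c (phi (fun i => L i c)) | c in unit_ball om].

Definition init_err d (om : freq d -> R) : \bar R :=
  ereal_sup [set ess_sup_T (fun x => cabs (feval c x)) | c in unit_ball om].

Definition nth_err d (om : freq d -> R) (Lam : set (fnl d)) (n : nat) : \bar R :=
  if n == 0%N then init_err om else
  ereal_inf [set e | exists (L : 'I_n -> fnl d) (phi : ('I_n -> C) -> pt d -> C),
                       (forall i, Lam (L i)) /\ e = alg_err om L phi].

Inductive criterion := ABS | NOR.

Definition CRI d (om : freq d -> R) (cr : criterion) : \bar R :=
  match cr with ABS => 1%E | NOR => init_err om end.

(* information complexity n^*(eps,d;Lam) as an extended real
   (+oo if no n achieves the error bound) *)
Definition nstar d (om : freq d -> R) (cr : criterion) (Lam : set (fnl d))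
    (eps : R) : \bar R :=
  ereal_inf [set (m%:R)%:E | m in
     [set m : nat | (nth_err om Lam m <= eps%:E * CRI om cr)%E]].

(* ln with the convention ln 0 = 0 (applied to values in {0} u [1, oo]) *)
Definition lnE (x : \bar R) : \bar R :=
  match x with
  | r%:E => (ln (Num.max 1 r))%:E
  | +oo%E => +oo%E
  | -oo%E => 0%E
  end.

Definition EXP_UWT (om : forall d : nat, freq d -> R) (cr : criterion)
    (Lam : forall d : nat, set (fnl d)) : Prop :=
  forall alpha beta : R, 0 < alpha -> 0 < beta ->
  forall eta : R, 0 < eta -> exists K : R,
  forall (d : nat) (eps : R), (0 < d)%N -> 0 < eps < 1 -> K < eps^-1 + d%:R ->
    (`| lnE (nstar (om d) cr (Lam d) eps)
         * (((1 + ln eps^-1) `^ alpha + d%:R `^ beta)^-1)%:E | < eta%:E)%E.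

End Defs.

(* Main.v *)
Require Import Defs.
From HB Require Import structures.
From mathcomp Require Import all_boot all_order all_algebra.
From mathcomp Require Import all_classical all_reals all_analysis.
From mathcomp Require Import perm.
From mathcomp.real_closed Require Import complex.
From mathcomp Require Import ring lra.
Set Implicit Arguments.
Unset Strict Implicit.
Unset Printing Implicit Defensive.
Import Order.TTheory GRing.Theory Num.Theory.
Local Open Scope classical_set_scope.
Local Open Scope ring_scope.

(* Using near-Fekete points twice gives e(n; std) <= (1 + 2n)^2 e(n; all). If u : X -> C^n is bounded, maximising a nonsingular minor of u up to
   a factor 2 gives points p_1, ..., p_n of X such that every u(x) is a
   combination of the u(p_j) with coefficients of modulus at most 2. Take for X
   the unit ball and for u the information (L_1, ..., L_n): there are g_1, ...,
   g_n in the ball such that every f in it is sum_j l_j g_j + h with h in the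
   common kernel of the L_i and |h| <= 1 + 2n; since h and -h share the same
   information, sup |h(x)| <= (1 + 2n) e(n; all). Now take for X the torus and
   for u the vector (g_1, ..., g_n): interpolating at the resulting points
   reproduces every g_j and has norm at most 2n, so the error of the sampling
   algorithm is at most (1 + 2n) sup |h(x)|. Polynomial factors in n are
   harmless for EXP-UWT: apply it for the class of all functionals at an eps'
   with ln (1 / eps') = 2 ln (1 / eps) + d^beta + 9. *)

(** * The real-valued modulus on the complex numbers *)

Section ComplexModulus.
Variable R : realType.
Local Notation C := (R[i]).
Implicit Types z w : C.

Lemma cabsE z : ((cabs z)%:C)%C = `|z|.
Proof. by case: z => a b; rewrite normc_def. Qed.

Lemma cabs_ge0 z : 0 <= cabs z.
Proof. by case: z => a b; exact: sqrtr_ge0. Qed.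

Lemma cabs0 : cabs (0 : C) = 0.
Proof. exact: ComplexField.Normc.normc0. Qed.

Lemma cabs1 : cabs (1 : C) = 1.
Proof. exact: ComplexField.Normc.normc1. Qed.

Lemma cabsM z w : cabs (z * w) = cabs z * cabs w.
Proof. exact: ComplexField.Normc.normcM. Qed.

Lemma cabsV z : cabs z^-1 = (cabs z)^-1.
Proof. exact: ComplexField.Normc.normcV. Qed.

Lemma cabs_eq0 z : (cabs z == 0) = (z == 0).
Proof.
apply/eqP/eqP => [|->]; [exact: ComplexField.Normc.eq0_normc|exact: cabs0].
Qed.

Lemma cabs_gt0 z : (0 < cabs z) = (z != 0).
Proof. by rewrite lt0r cabs_ge0 andbT cabs_eq0. Qed.

Lemma cabsD z w : cabs (z + w) <= cabs z + cabs w.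
Proof. by rewrite -lecR rmorphD /= !cabsE ler_normD. Qed.

Lemma cabsN z : cabs (- z) = cabs z.
Proof. by apply: complexI; rewrite !cabsE normrN. Qed.

Lemma cabsB z w : cabs (z - w) = cabs (w - z).
Proof. by rewrite -cabsN opprB. Qed.

Lemma cabs_real (r : R) : cabs (r%:C)%C = `|r|.
Proof. by rewrite /cabs /= expr0n addr0 sqrtr_sqr. Qed.

Lemma cabs_Re z : `|complex.Re z| <= cabs z.
Proof.
case: z => a b; rewrite /cabs /= -sqrtr_sqr.
by rewrite ler_wsqrtr // lerDl sqr_ge0.
Qed.

Lemma cabs_Im z : `|complex.Im z| <= cabs z.
Proof.
case: z => a b; rewrite /cabs /= -(sqrtr_sqr b).
by rewrite ler_wsqrtr // lerDr sqr_ge0.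
Qed.

Lemma cabs_ReIm z : cabs z <= `|complex.Re z| + `|complex.Im z|.
Proof.
rewrite [X in cabs X](complexE z); apply: le_trans (cabsD _ _) _.
by rewrite cabsM !cabs_real /cabs /= expr0n expr1n add0r sqrtr1 mul1r.
Qed.

Lemma cabs_sum (I : Type) (s : seq I) (P : pred I) (F : I -> C) :
  cabs (\sum_(i <- s | P i) F i) <= \sum_(i <- s | P i) cabs (F i).
Proof.
elim/big_rec2: _ => [|i y x _ le_xy]; first by rewrite cabs0.
by apply: le_trans (cabsD _ _) _; rewrite lerD2l.
Qed.

Lemma cabs_prod (I : Type) (s : seq I) (P : pred I) (F : I -> C) :
  cabs (\prod_(i <- s | P i) F i) = \prod_(i <- s | P i) cabs (F i).
Proof. by elim/big_rec2: _ => [|i y x _ <-]; rewrite ?cabs1 ?cabsM. Qed.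

Lemma cabs_sign (b : bool) : cabs ((-1) ^+ b : C) = 1.
Proof. by case: b; rewrite ?expr1 ?expr0 ?cabsN cabs1. Qed.

End ComplexModulus.

(** * Unconditional summation of complex families *)

Section UnconditionalSums.
Variable R : realType.
Local Notation C := (R[i]).
Variable K : eqType.
Implicit Types (F G : K -> C) (S : seq K).

Lemma has_sum_unique F v w : has_sum F v -> has_sum F w -> v = w.
Proof.
move=> Fv Fw; apply/eqP; rewrite -subr_eq0 -cabs_eq0.
apply/eqP/le_anti; rewrite cabs_ge0 andbT; apply/ler_addgt0Pl => e e0.
have [S1 S1P] := Fv _ (divr_gt0 e0 (ltr0n _ 2)).
have [S2 S2P] := Fw _ (divr_gt0 e0 (ltr0n _ 2)).
set S := undup (S1 ++ S2).
have S1S : {subset S1 <= S} by move=> k; rewrite mem_undup mem_cat => ->.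
have S2S : {subset S2 <= S} by move=> k; rewrite mem_undup mem_cat orbC => ->.
have := S1P S (undup_uniq _) S1S; have := S2P S (undup_uniq _) S2S.
rewrite addr0 cabsB => h2 h1.
have -> : v - w = - (\sum_(k <- S) F k - v) - (w - \sum_(k <- S) F k) by ring.
by rewrite (le_trans (cabsD _ _))// !cabsN; lra.
Qed.

Lemma has_sumZD (a : C) F G v w : has_sum F v -> has_sum G w ->
  has_sum (fun k => a * F k + G k) (a * v + w).
Proof.
move=> Fv Gw e e0.
have a1 : 0 < 1 + cabs a by rewrite ltr_pwDl ?cabs_ge0.
have e1 : 0 < e / 2 / (1 + cabs a) by rewrite !divr_gt0.
have [S1 S1P] := Fv _ e1; have [S2 S2P] := Gw _ (divr_gt0 e0 (ltr0n _ 2)).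
exists (S1 ++ S2) => S uS S12.
have {}S1P : cabs (\sum_(k <- S) F k - v) < e / 2 / (1 + cabs a).
  by apply: S1P => // k kS; apply: S12; rewrite mem_cat kS.
have {}S2P : cabs (\sum_(k <- S) G k - w) < e / 2.
  by apply: S2P => // k kS; apply: S12; rewrite mem_cat kS orbT.
rewrite big_split /= -mulr_sumr.
rewrite [X in cabs X](_ : _ = a * (\sum_(k <- S) F k - v) +
  (\sum_(k <- S) G k - w)); last by ring.
apply: (le_lt_trans (cabsD _ _)); rewrite cabsM.
have -> : e = e / 2 + e / 2 by field.
apply: ler_ltD => //; move: S1P; rewrite ltr_pdivlMr // => /ltW.
by apply: le_trans; rewrite mulrC ler_wpM2l ?cabs_ge0 // lerDr.
Qed.

Lemma sum_uniq_sub (V : nmodType) (F : K -> V) S0 S :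
  uniq S0 -> uniq S -> {subset S0 <= S} ->
  \sum_(k <- S) F k =
  \sum_(k <- S0) F k + \sum_(k <- [seq k <- S | k \notin S0]) F k.
Proof.
move=> u0 uS sub; rewrite (bigID (mem S0)) /= big_filter; congr (_ + _).
rewrite -big_filter; apply: perm_big; apply: uniq_perm; rewrite ?filter_uniq //.
by move=> k; rewrite mem_filter; case: (boolP (k \in S0)) => // /sub ->.
Qed.

(** Absolute summability, phrased with finite sums so that no extended reals enter. *)
Definition abs_bounded F (B : R) :=
  forall S, uniq S -> \sum_(k <- S) cabs (F k) <= B.

Lemma has_sum_le F v B : abs_bounded F B -> has_sum F v -> cabs v <= B.
Proof.
move=> FB Fv; apply/ler_addgt0Pl => e e0; have [S0 S0P] := Fv _ e0.
have uS := undup_uniq S0.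
have := S0P _ uS (fun k kS => etrans (mem_undup S0 k) kS).
have := le_trans (cabs_sum _ _ _) (FB _ uS); set s := \sum_(k <- _) _ => sB sv.
have -> : v = (v - s) + s by ring.
by apply: le_trans (cabsD _ _) _; rewrite lerD // cabsB ltW.
Qed.

(** The sum is the supremum of the finite sums; by monotonicity a near-maximal finite set witnesses
    convergence. *)
Lemma has_sum_nneg (F : K -> R) (B : R) : (forall k, 0 <= F k) ->
  (forall S, uniq S -> \sum_(k <- S) F k <= B) ->
  exists v : C, has_sum (fun k => (F k)%:C%C) v.
Proof.
move=> F0 FB; set E := [set \sum_(k <- S) F k | S in [set S | uniq S]].
have supE : has_sup E.
  split; first by exists (\sum_(k <- [::]) F k); exists [::].
  by exists B => _ [S uS <-]; exact: FB.
exists ((sup E)%:C)%C => e e0.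
have [_ [S0 /= uS0 <-] S0P] := sup_adherent e0 supE.
exists S0 => S uS sub.
rewrite [X in cabs X](_ : _ = ((\sum_(k <- S) F k - sup E)%:C)%C); last first.
  by rewrite rmorphB rmorph_sum.
rewrite cabs_real.
have leS : \sum_(k <- S) F k <= sup E by apply: ub_le_sup; [case: supE|exists S].
rewrite distrC ger0_norm ?subr_ge0 // ltrBlDr -ltrBlDl.
apply: lt_le_trans S0P _; rewrite (sum_uniq_sub _ uS0 uS sub) lerDl.
exact: sumr_ge0.
Qed.

(** Reduction to nonnegative families: z = (Re z + |z|) + i (Im z + |z|) - (1 + i) |z|, where both
    brackets lie between 0 and 2 |z|. *)
Lemma has_sum_ex F B : abs_bounded F B -> exists v, has_sum F v.
Proof.
move=> FB.
have part (p : C -> R) : (forall z, 0 <= p z <= 2 * cabs z) ->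
    exists v, has_sum (fun k => (p (F k))%:C%C) v.
  move=> pP; apply: (@has_sum_nneg _ (2 * B)) => [k|S uS].
    by have /andP[] := pP (F k).
  apply: le_trans (_ : \sum_(k <- S) 2 * cabs (F k) <= _).
    by apply: ler_sum => k _; have /andP[] := pP (F k).
  by rewrite -mulr_sumr ler_wpM2l // FB.
have [v1 h1] := part (fun z => complex.Re z + cabs z) ltac:(by move=> z /=;
  have := cabs_Re z; rewrite ler_norml => /andP[]; lra).
have [v2 h2] := part (fun z => complex.Im z + cabs z) ltac:(by move=> z /=;
  have := cabs_Im z; rewrite ler_norml => /andP[]; lra).
have [v3 h3] := part (@cabs R) ltac:(by move=> z /=;
  have := cabs_ge0 z; lra).
have h4 := has_sumZD (-1) h3 (has_sumZD 'i%C h2 (has_sumZD (- 'i%C) h3 h1)).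
exists (-1 * v3 + ('i%C * v2 + (- 'i%C * v3 + v1))).
have -> // : F = fun k => -1 * ((cabs (F k))%:C)%C +
  ('i * ((complex.Im (F k) + cabs (F k))%:C)%C +
   (- 'i * ((cabs (F k))%:C)%C + ((complex.Re (F k) + cabs (F k))%:C)%C))%C.
apply/funext => k; case: (F k) => a b; apply/eqP; rewrite eq_complex /=.
by apply/andP; split; apply/eqP; ring.
Qed.

(** A finite set carrying almost all of the absolute mass works for every multiplier [a] at once;
    with [a] the exponentials at a point, the approximation is uniform in that point. *)
Lemma has_sum_tail F B (e : R) : abs_bounded F B -> 0 < e ->
  exists2 S0 : seq K, uniq S0 & forall (a : K -> C) v,
    (forall k, cabs (a k) <= 1) -> has_sum (fun k => F k * a k) v ->
    cabs (v - \sum_(k <- S0) F k * a k) <= e.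
Proof.
move=> FB e0; set E := [set \sum_(k <- S) cabs (F k) | S in [set S | uniq S]].
have supE : has_sup E.
  split; first by exists (\sum_(k <- [::]) cabs (F k)); exists [::].
  by exists B => _ [S uS <-]; exact: FB.
have [_ [S0 /= uS0 <-] S0P] := sup_adherent e0 supE.
exists S0 => // a v a1 hv; apply/ler_addgt0Pl => e' e'0.
have [S1 S1P] := hv _ e'0; set S := undup (S0 ++ S1).
have uS : uniq S := undup_uniq _.
have sub0 : {subset S0 <= S} by move=> k kS; rewrite mem_undup mem_cat kS.
have {}S1P : cabs (\sum_(k <- S) F k * a k - v) < e'.
  by apply: S1P => // k kS; rewrite mem_undup mem_cat kS orbT.
have leS : \sum_(k <- S) cabs (F k) <= sup E.
  by apply: ub_le_sup; [case: supE|exists S].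
move: S1P leS; rewrite !(sum_uniq_sub _ uS0 uS sub0).
set T := [seq k <- S | _]; move=> S1P leS.
have : cabs (\sum_(k <- T) F k * a k) <= \sum_(k <- T) cabs (F k).
  apply: le_trans (cabs_sum _ _ _) _; apply: ler_sum => k _.
  by rewrite cabsM ler_piMr ?cabs_ge0.
move: S1P; set s0 := \sum_(k <- S0) F k * a k; set t := \sum_(k <- T) _ * _.
move=> S1P tT; have -> : v - s0 = - (s0 + t - v) + t by ring.
by apply: le_trans (cabsD _ _) _; rewrite cabsN; lra.
Qed.

End UnconditionalSums.

(** * Near-Fekete points and interpolation with bounded coefficients *)

Section NearFeketePoints.
Variables (R : realType) (T : Type).
Local Notation C := (R[i]).

(** Bounding the r! terms of the Leibniz expansion is crude, but it serves only to make a supremum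
    of determinants finite. *)
Lemma cabs_det_le r (A : 'M[C]_r) (B : R) :
  (forall (i j : 'I_r), cabs (A i j) <= B) ->
  cabs (\det A) <= \sum_(s : 'S_r) B ^+ r.
Proof.
move=> AB; apply: le_trans (cabs_sum _ _ _) _; apply: ler_sum => s _.
rewrite cabsM cabs_sign mul1r cabs_prod.
have -> : B ^+ r = \prod_(i < r) B by rewrite prodr_const card_ord.
by apply: ler_prod => i _; rewrite cabs_ge0 AB.
Qed.

(** Block elimination leaves the Schur complement [d - c *m invmx A *m b] as the only factor that
    can vanish. *)
Lemma det_bordered_eq0 r (A : 'M[C]_r) b c (d : 'M[C]_1) :
  A \in unitmx ->
  \det (block_mx A b c d) = 0 -> d = c *m invmx A *m b.
Proof.
move=> uA.
have -> : block_mx A b c d = block_mx A 0 c 1%:M *m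
    block_mx 1%:M (invmx A *m b) 0 (d - c *m invmx A *m b).
  rewrite mulmx_block !mulmx1 !mulmx0 !mul0mx !addr0 !mul1mx.
  by rewrite !mulmxA mulmxV // mul1mx addrC subrK.
rewrite det_mulmx det_lblock det_ublock !det1 mulr1 mul1r det_mx11 => /eqP.
rewrite mulf_eq0 -[X in X || _]negbK -unitfE -unitmxE uA /= => /eqP h.
apply/eqP; rewrite -subr_eq0; apply/eqP/matrixP => i j.
by rewrite !ord1 h mxE.
Qed.

(* Cramer's rule: coordinates in the basis of columns of A are quotients of
   determinants with one column replaced. *)
Lemma cramer r (A : 'M[C]_r) (b : 'cV[C]_r) j : A \in unitmx ->
  (invmx A *m b) j 0 =
  \det (\matrix_(i, k) if k == j then b i 0 else A i k) / \det A.
Proof.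
move=> uA; rewrite /invmx uA -scalemxAl mxE mulrC; congr (_ / _).
rewrite (expand_det_col _ j) mxE; apply: eq_bigr => i _.
rewrite [RHS]mulrC; congr (_ * _); last by rewrite mxE eqxx.
rewrite mxE /cofactor; congr (_ * _); congr (\det _).
by apply/matrixP => k l; rewrite !mxE eq_sym (negbTE (neq_lift _ _)).
Qed.

Variables (X : set T) (n : nat) (u : T -> 'I_n -> C) (B : R) (x0 : T).
Hypothesis Xx0 : X x0.
Hypothesis uB : forall x i, X x -> cabs (u x i) <= B.

Let minor r (f : 'I_r -> 'I_n) (p : 'I_r -> T) : 'M[C]_r :=
  \matrix_(i, j) u (p j) (f i).

Let has_minor r := exists (f : 'I_r -> 'I_n) (p : 'I_r -> T),
  (forall j, X (p j)) /\ minor f p \in unitmx.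

(** The minor selects rows of a matrix with n rows, so its full rank r is at most n. *)
Let has_minor_le r : has_minor r -> (r <= n)%N.
Proof.
move=> [f [p [_ uM]]].
have E : minor f p = rowsub f 1%:M *m \matrix_(i, j) u (p j) i.
  by rewrite mul_rowsub_mx mul1mx; apply/matrixP => i j; rewrite !mxE.
rewrite -(mxrank_unit uM) E; apply: leq_trans (mxrankM_maxr _ _) _.
exact: rank_leq_row.
Qed.

(* Extending a maximal nonsingular minor by any point and any coordinate makes
   it singular. *)
Let maximal_minor : exists r (f : 'I_r -> 'I_n) (p0 : 'I_r -> T),
  [/\ (r <= n)%N, forall j, X (p0 j), minor f p0 \in unitmx &
   forall p x i, (forall j, X (p j)) -> X x -> minor f p \in unitmx ->
     u x i = \sum_j (invmx (minor f p) *m \col_k u x (f k)) j 0 * u (p j) i].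
Proof.
have h0 : exists r, `[< has_minor r >].
  (* The empty minor has determinant 1, so the search for a maximal order starts at 0. *)
  exists 0%N; apply/asboolP; exists (fun i : 'I_0 =>
    False_rect _ (notF (etrans (esym (ltn0 i)) (ltn_ord i)))).
  by exists (fun=> x0); split => //; rewrite unitmxE det_mx00 unitr1.
have hn r : `[< has_minor r >] -> (r <= n)%N by move/asboolP/has_minor_le.
case: (ex_maxnP h0 hn) => r /asboolP hr rmax.
have [f [p0 [Xp0 up0]]] := hr; exists r, f, p0; split => //.
  exact: has_minor_le.
move=> p x i Xp Xx uM.
pose f' (k : 'I_(r + 1)) := if fintype.split k is inl k' then f k' else i.
pose p' (k : 'I_(r + 1)) := if fintype.split k is inl k' then p k' else x.
have E : minor f' p' = block_mx (minor f p) (\col_k u x (f k))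
                                (\row_j u (p j) i) (u x i)%:M.
  apply/matrixP => k l; rewrite !mxE /f' /p'.
  by case: (fintype.split k) => a; rewrite mxE; case: (fintype.split l) => b;
    rewrite !mxE ?ord1 ?eqxx ?mulr1n.
have /(det_bordered_eq0 uM)/matrixP/(_ 0 0) :
    \det (block_mx (minor f p) (\col_k u x (f k))
                   (\row_j u (p j) i) (u x i)%:M) = 0.
  apply/eqP; rewrite -E; apply/negP => /negP; rewrite -unitfE -unitmxE => uM'.
  have := rmax (r + 1)%N; rewrite addn1 ltnn => h; apply/notF/h.
  rewrite -addn1; apply/asboolP; exists f', p'; split => // j.
  by rewrite /p'; case: fintype.split.
rewrite mxE eqxx mulr1n => ->; rewrite -mulmxA mxE; apply: eq_bigr => j _.
by rewrite mxE mulrC.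
Qed.

Lemma near_fekete : exists p : 'I_n -> T, (forall j, X (p j)) /\
  forall x, X x -> exists l : 'I_n -> C,
    (forall j, cabs (l j) <= 2) /\ forall i, u x i = \sum_j l j * u (p j) i.
Proof.
have [r [f [p0 [rn Xp0 up0 hu]]]] := maximal_minor.
have [p [Xp [up pmax]]] : exists p, (forall j, X (p j)) /\
    (minor f p \in unitmx /\ forall q, (forall j, X (q j)) ->
      cabs (\det (minor f q)) <= 2 * cabs (\det (minor f p))).
  (* [X] is arbitrary, so the supremum need not be attained; a value above half of it costs the
     factor 2. *)
  pose E := [set cabs (\det (minor f q)) | q in [set q | forall j, X (q j)]].
  have supE : has_sup E.
    split; first by exists (cabs (\det (minor f p0))), p0.
    exists (\sum_(s : 'S_r) B ^+ r) => _ [q Xq <-]; apply: cabs_det_le => i j.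
    by rewrite mxE uB.
  have leE q : (forall j, X (q j)) -> cabs (\det (minor f q)) <= sup E.
    by move=> Xq; apply: ub_le_sup; [case: supE|exists q].
  have E0 : 0 < sup E.
    by apply: lt_le_trans (leE _ Xp0); rewrite cabs_gt0 -unitfE -unitmxE.
  have [_ [p Xp <-] pP] := sup_adherent (divr_gt0 E0 (ltr0n _ 2)) supE.
  exists p; split => //; split; first by
    rewrite unitmxE unitfE -cabs_gt0; lra.
  by move=> q /leE; lra.
have {}hu x : X x -> exists l : 'I_r -> C,
    (forall j, cabs (l j) <= 2) /\ forall i, u x i = \sum_j l j * u (p j) i.
  move=> Xx; exists (fun j => (invmx (minor f p) *m \col_k u x (f k)) j 0).
  split=> [j|i]; last exact: hu.
  (* By Cramer's rule the coordinate is a quotient of two minors, the upper one with [p j] replaced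
     by [x]. *)
  rewrite cramer // cabsM cabsV ler_pdivrMr; last first.
    by rewrite cabs_gt0 -unitfE -unitmxE.
  apply: le_trans (pmax (fun k => if k == j then x else p k) _) => [|k].
    rewrite le_eqVlt; apply/orP; left; apply/eqP; congr (cabs (\det _)).
    by apply/matrixP => i k; rewrite !mxE; case: ifP.
  by case: ifP.
(* When r < n the list of points is filled up with [x0], which gets coefficient 0. *)
have [m nE] : exists m, n = (r + m)%N by exists (n - r)%N; rewrite subnKC.
exists (fun j => if fintype.split (cast_ord nE j) is inl j' then p j' else x0).
split=> [j|x /hu [l [l2 lu]]]; first by case: fintype.split.
exists (fun j => if fintype.split (cast_ord nE j) is inl j' then l j' else 0).
split=> [j|i]; first by case: fintype.split => // _; rewrite cabs0.
rewrite lu (reindex (cast_ord (esym nE))) /=; last first.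
  by exists (cast_ord nE) => j _; rewrite ?cast_ordK ?cast_ordKV.
rewrite big_split_ord /= [X in _ + X]big1 ?addr0 => [|j _]; last first.
  by rewrite cast_ordKV (unsplitK (inr j)) mul0r.
apply: eq_bigr => j _; rewrite cast_ordKV.
by rewrite (unsplitK (inl j)).
Qed.

End NearFeketePoints.

(** * The weighted Hilbert space and its point evaluations *)

Section WeightedSpace.
Variable R : realType.
Local Notation C := (R[i]).

Lemma cauchy_schwarz_seq (I : Type) (s : seq I) (a b : I -> R) :
  (\sum_(i <- s) a i * b i) ^+ 2 <=
  (\sum_(i <- s) a i ^+ 2) * (\sum_(i <- s) b i ^+ 2).
Proof.
elim: s => [|i s IH]; first by rewrite !big_nil expr0n mul0r.
rewrite !big_cons; move: IH.
have : 0 <= \sum_(i <- s) a i ^+ 2 by apply: sumr_ge0 => j _; exact: sqr_ge0.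
have : 0 <= \sum_(i <- s) b i ^+ 2 by apply: sumr_ge0 => j _; exact: sqr_ge0.
move: (\sum_(i <- s) a i * b i) => p; move: (\sum_(i <- s) b i ^+ 2) => q.
move: (\sum_(i <- s) a i ^+ 2) => r; move: (a i) (b i) => x y q0 r0 pqr.
(* Since p^2 <= r q, comparing squares suffices: (r y^2 + q x^2)^2 - (2 p x y)^2 = (r y^2 - q x^2)^2
   + 4 (r q - p^2) (x y)^2. *)
suff h : 2 * (p * x * y) <= r * y ^+ 2 + q * x ^+ 2.
  rewrite -subr_ge0 [X in 0 <= X](_ : _ = (r * q - p ^+ 2) +
    (r * y ^+ 2 + q * x ^+ 2 - 2 * (p * x * y))); last by ring.
  by rewrite addr_ge0 ?subr_ge0.
have h0 : 0 <= r * y ^+ 2 + q * x ^+ 2.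
  by rewrite addr_ge0 // mulr_ge0 ?sqr_ge0.
apply: le_trans (ler_norm _) _; rewrite -ler_sqr ?nnegrE // real_normK ?num_real //.
rewrite -subr_ge0 [X in 0 <= X](_ : _ = (r * y ^+ 2 - q * x ^+ 2) ^+ 2 +
  4 * ((r * q - p ^+ 2) * (x * y) ^+ 2)); last by ring.
by rewrite addr_ge0 ?sqr_ge0 // mulr_ge0 // mulr_ge0 ?sqr_ge0 ?subr_ge0.
Qed.

Lemma esum_leP (K : choiceType) (F : K -> R) (B : R) :
  (\esum_(k in [set: K]) (F k)%:E <= B%:E)%E <->
  forall S, uniq S -> \sum_(k <- S) F k <= B.
Proof.
split=> [FB S uS|FB].
  rewrite -lee_fin; apply: le_trans FB; apply: ereal_sup_ubound.
  exists [set` S]; first by split.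
  by rewrite -fsbig_seq // sumEFin.
apply: ge_ereal_sup => _ [A [finA _] <-].
by rewrite fsbig_finite // sumEFin lee_fin FB.
Qed.

Variables (d : nat) (om : freq d -> R).
Implicit Types (c : freq d -> C) (x y : pt R d) (k : freq d).

Lemma hnorm2_leP c (N : R) : (hnorm2 om c <= N%:E)%E <->
  forall S, uniq S -> \sum_(k <- S) cabs (c k) ^+ 2 * om k ^+ 2 <= N.
Proof. exact: esum_leP. Qed.

Lemma hnorm2_ge0 c : (0 <= hnorm2 om c)%E.
Proof. by apply: esum_ge0 => k _; rewrite lee_fin mulr_ge0 ?sqr_ge0. Qed.

(** Replaces finiteness by a bound s^2, the form in which the triangle inequality below is
    stated. *)
Lemma inHP c : inH om c <-> exists2 s, 0 <= s & (hnorm2 om c <= (s ^+ 2)%:E)%E.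
Proof.
rewrite /inH /=; split=> [h|[s _ /le_lt_trans -> //]]; last exact: ltry.
have f : hnorm2 om c \is a fin_num by rewrite ge0_fin_numE // hnorm2_ge0.
exists (Num.sqrt (fine (hnorm2 om c))); first exact: sqrtr_ge0.
by rewrite sqr_sqrtr ?fine_ge0 ?hnorm2_ge0 // fineK.
Qed.

Lemma unit_ball_inH c : unit_ball om c -> inH om c.
Proof. by move=> h; apply/inHP; exists 1 => //; rewrite expr1n. Qed.

(** Expanding the square leaves a cross term that Cauchy-Schwarz bounds by s t; this is the triangle
    inequality of the norm. *)
Lemma hnorm2_ZD (a : C) c1 c2 s t : 0 <= s -> 0 <= t ->
  (hnorm2 om c1 <= (s ^+ 2)%:E)%E -> (hnorm2 om c2 <= (t ^+ 2)%:E)%E ->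
  (hnorm2 om (fun k => (a * c1 k + c2 k)%R) <= ((cabs a * s + t) ^+ 2)%:E)%E.
Proof.
move=> s0 t0 /hnorm2_leP h1 /hnorm2_leP h2; apply/hnorm2_leP => S uS.
move: (h1 S uS) (h2 S uS) => {}h1 {}h2.
set A := \sum_(k <- S) cabs (c1 k) ^+ 2 * om k ^+ 2 in h1.
set B := \sum_(k <- S) cabs (c2 k) ^+ 2 * om k ^+ 2 in h2.
set P := \sum_(k <- S) (cabs (c1 k) * om k) * (cabs (c2 k) * om k).
apply: le_trans (_ : cabs a ^+ 2 * A + 2 * cabs a * P + B <= _).
  rewrite !mulr_sumr -!big_split /=; apply: ler_sum => k _.
  rewrite [leRHS](_ : _ = (cabs a * cabs (c1 k) + cabs (c2 k)) ^+ 2 * om k ^+ 2);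
    last by ring.
  rewrite ler_wpM2r ?sqr_ge0 // ler_sqr ?nnegrE ?cabs_ge0 //.
    by rewrite -cabsM cabsD.
  by rewrite addr_ge0 ?mulr_ge0 ?cabs_ge0.
have P_le : P <= s * t.
  apply: le_trans (ler_norm _) _; rewrite -ler_sqr ?nnegrE ?mulr_ge0 //.
  rewrite real_normK ?num_real // exprMn; apply: le_trans (cauchy_schwarz_seq _ _ _) _.
  apply: ler_pM => //; try by apply: sumr_ge0 => k _; exact: sqr_ge0.
    by apply: le_trans h1; apply: ler_sum => k _; rewrite exprMn.
  by apply: le_trans h2; apply: ler_sum => k _; rewrite exprMn.
rewrite [leRHS](_ : _ = cabs a ^+ 2 * s ^+ 2 + 2 * cabs a * (s * t) + t ^+ 2);
  last by ring.
by rewrite !lerD // ler_wpM2l ?sqr_ge0 // mulr_ge0 ?cabs_ge0.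
Qed.

Lemma inH_ZD (a : C) c1 c2 : inH om c1 -> inH om c2 ->
  inH om (fun k => a * c1 k + c2 k).
Proof.
move=> /inHP[s s0 h1] /inHP[t t0 h2]; apply/inHP.
exists (cabs a * s + t); first by rewrite addr_ge0 ?mulr_ge0 ?cabs_ge0.
exact: hnorm2_ZD.
Qed.

(** Restricted to finite-norm coefficients because the series of [feval] may diverge elsewhere. *)
Definition linear_on_H (L : fnl R d) := forall (a : C) c1 c2,
  inH om c1 -> inH om c2 -> L (fun k => a * c1 k + c2 k) = a * L c1 + L c2.

Lemma linear_on_H0 L : linear_on_H L -> L (fun=> 0) = 0.
Proof.
move=> linL; have H0 : inH om (fun=> 0).
  apply/inHP; exists 0 => //; apply/hnorm2_leP => S _.
  by rewrite big1 ?expr0n // => k _; rewrite cabs0 expr0n mul0r.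
have := linL 1 _ _ H0 H0; under eq_fun do rewrite mulr0 addr0.
by rewrite mul1r => /eqP; rewrite -subr_eq0 opprD addNKr oppr_eq0 => /eqP.
Qed.

Lemma linear_on_HZ L (a : C) c : linear_on_H L -> inH om c ->
  L (fun k => a * c k) = a * L c.
Proof.
move=> linL Hc; have H0 : inH om (fun=> 0).
  apply/inHP; exists 0 => //; apply/hnorm2_leP => S _.
  by rewrite big1 ?expr0n // => k _; rewrite cabs0 expr0n mul0r.
have := linL a _ _ Hc H0; under eq_fun do rewrite addr0.
by rewrite linear_on_H0 // addr0.
Qed.

Lemma hnorm2Z (a : C) c s : 0 <= s -> (hnorm2 om c <= (s ^+ 2)%:E)%E ->
  (hnorm2 om (fun k => (a * c k)%R) <= ((cabs a * s) ^+ 2)%:E)%E.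
Proof.
move=> s0 h.
have h0 : (hnorm2 om (fun=> 0%R) <= (0 ^+ 2 : R)%:E)%E.
  apply/hnorm2_leP => S _.
  by rewrite big1 ?expr0n // => k _; rewrite cabs0 expr0n mul0r.
have := hnorm2_ZD a s0 (lexx 0) h h0.
by rewrite addr0; under eq_fun do rewrite addr0.
Qed.

(** Each subtracted term costs at most 2 in norm. The norm bound and the values go through one
    induction, since linearity may be used only on finite-norm elements. *)
Lemma residual (I : Type) (s : seq I) (l : I -> C) (g : I -> freq d -> C) c :
  unit_ball om c -> (forall i, unit_ball om (g i)) ->
  (forall i, cabs (l i) <= 2) ->
  let h := fun k => c k - \sum_(i <- s) l i * g i k in
  (hnorm2 om h <= ((1 + 2 * (size s)%:R) ^+ 2)%:E)%E /\
  forall L, linear_on_H L -> L h = L c - \sum_(i <- s) l i * L (g i).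
Proof.
move=> Bc Bg l2; elim: s => [|i s [IHn IHl]] h.
  have -> : h = c by apply/funext => k; rewrite /h big_nil subr0.
  by rewrite mulr0 addr0 expr1n; split => // L _; rewrite big_nil subr0.
have -> : h = fun k => - l i * g i k + (c k - \sum_(i <- s) l i * g i k).
  by apply/funext => k; rewrite /h big_cons; ring.
have s0 : 0 <= 1 + 2 * (size s)%:R :> R by rewrite addr_ge0 ?mulr_ge0.
have Bgi : (hnorm2 om (g i) <= (1 ^+ 2 : R)%:E)%E by rewrite expr1n; exact: Bg.
split; last first.
  move=> L linL; rewrite linL ?IHl ?big_cons //; first by ring.
    exact: unit_ball_inH.
  by apply/inHP; exists (1 + 2 * (size s)%:R).
apply: le_trans (hnorm2_ZD (- l i) ler01 s0 Bgi IHn) _.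
rewrite lee_fin ler_sqr ?nnegrE ?addr_ge0 ?mulr_ge0 ?cabs_ge0 //.
rewrite cabsN mulr1 /= -natr1; have := l2 i; lra.
Qed.

Hypothesis om0 : forall k, 0 < om k.
Variable W : R.
Hypothesis omW : (\esum_(k in [set: freq d]) ((om k ^+ 2)^-1)%:E <= W%:E)%E.

Lemma sampling_const_ge0 : 0 <= W.
Proof.
by rewrite -lee_fin; apply: le_trans omW; apply: esum_ge0 => k _;
  rewrite lee_fin invr_ge0 sqr_ge0.
Qed.

(** Cauchy-Schwarz applied to |c k| om k and 1 / om k; absolute convergence of the Fourier series,
    uniformly in the point, rests on it. *)
Lemma coef_abs_bounded c N : (hnorm2 om c <= N%:E)%E ->
  abs_bounded c (Num.sqrt (N * W)).
Proof.
move=> /hnorm2_leP cN S uS.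
have -> : \sum_(k <- S) cabs (c k) =
    \sum_(k <- S) (cabs (c k) * om k) * (om k)^-1.
  by apply: eq_bigr => k _; rewrite mulfK ?gt_eqF.
apply: le_trans (ler_norm _) _; rewrite -sqrtr_sqr ler_wsqrtr //.
apply: le_trans (cauchy_schwarz_seq _ _ _) _; apply: ler_pM.
- by apply: sumr_ge0 => k _; exact: sqr_ge0.
- by apply: sumr_ge0 => k _; exact: sqr_ge0.
- by apply: le_trans (cN S uS); apply: ler_sum => k _; rewrite exprMn.
- have /esum_leP/(_ S uS) := omW; apply: le_trans; apply: ler_sum => k _.
  by rewrite exprVn.
Qed.

Lemma cabs_expk k x : cabs (expk k x) = 1.
Proof. by rewrite /cabs /expk /= cos2Dsin2 sqrtr1. Qed.

Lemma series_abs_bounded c N x : (hnorm2 om c <= N%:E)%E ->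
  abs_bounded (fun k => c k * expk k x) (Num.sqrt (N * W)).
Proof.
move=> /coef_abs_bounded cN S /cN; apply: le_trans; apply: ler_sum => k _.
by rewrite cabsM cabs_expk mulr1.
Qed.

(** Absolute convergence provides the sum that [xget] picks. *)
Lemma feval_has_sum c x : inH om c ->
  has_sum (fun k => c k * expk k x) (feval c x).
Proof.
move=> /inHP[s s0 h]; apply: (@xgetPex _ 0 [set v | has_sum _ v]).
exact: has_sum_ex (series_abs_bounded x h).
Qed.

Lemma feval_linear x : linear_on_H (fun c => feval c x).
Proof.
move=> a c1 c2 h1 h2; apply: has_sum_unique.
  exact: feval_has_sum (inH_ZD a h1 h2).
have := has_sumZD a (feval_has_sum x h1) (feval_has_sum x h2).
by congr has_sum; apply/funext => k; ring.
Qed.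

Lemma feval_le c N x : (hnorm2 om c <= N%:E)%E ->
  cabs (feval c x) <= Num.sqrt (N * W).
Proof.
move=> h; apply: has_sum_le (series_abs_bounded x h) _; apply: feval_has_sum.
by apply: le_lt_trans h _; exact: ltry.
Qed.

(** By [feval_le], [Num.sqrt W] bounds the norm of every point evaluation. *)
Lemma Lam_std_sub_Lam_all : @Lam_std R d `<=` Lam_all om.
Proof.
move=> _ [x _ ->]; split; first exact: feval_linear.
exists (Num.sqrt W) => c Hc; rewrite sqr_sqrtr ?sampling_const_ge0 //.
have f : hnorm2 om c \is a fin_num by rewrite ge0_fin_numE // hnorm2_ge0.
rewrite -(fineK f) -EFinM lee_fin.
have N0 : 0 <= fine (hnorm2 om c) by rewrite fine_ge0 ?hnorm2_ge0.
rewrite -[leRHS]sqr_sqrtr ?mulr_ge0 ?sampling_const_ge0 //.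
rewrite ler_sqr ?nnegrE ?cabs_ge0 ?sqrtr_ge0 // mulrC.
by apply: feval_le; rewrite fineK.
Qed.

End WeightedSpace.

Local Notation null_set := Defs.null_set.

(** * Continuity of the Fourier series *)

Section Continuity.
Variables (R : realType) (d : nat).
Local Notation C := (R[i]).
Implicit Types (x y : pt R d) (k : freq d).

(** Closed cubes serve as neighbourhoods, matching the relative neighbourhoods of
    [nbhs_not_null]. *)
Definition continuous_at (f : pt R d -> C) x := forall e : R, 0 < e ->
  exists2 delta, 0 < delta & forall y, (forall i, `|y i - x i| <= delta) ->
    cabs (f y - f x) <= e.

Lemma continuous_at_ZD (a : C) f g x : continuous_at f x -> continuous_at g x ->
  continuous_at (fun y => a * f y + g y) x.
Proof.
move=> cf cg e e0; have a1 : 0 < 1 + cabs a by rewrite ltr_pwDl ?cabs_ge0.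
have [d1 d10 h1] := cf (e / 2 / (1 + cabs a)) ltac:(by rewrite !divr_gt0).
have [d2 d20 h2] := cg (e / 2) ltac:(by rewrite divr_gt0).
exists (Num.min d1 d2) => [|y yx]; first by rewrite lt_min d10.
have {}h1 : cabs (f y - f x) <= e / 2 / (1 + cabs a).
  by apply: h1 => i; apply: le_trans (yx i) _; rewrite ge_min lexx.
have {}h2 : cabs (g y - g x) <= e / 2.
  by apply: h2 => i; apply: le_trans (yx i) _; rewrite ge_min lexx orbT.
rewrite [X in cabs X](_ : _ = a * (f y - f x) + (g y - g x)); last by ring.
apply: le_trans (cabsD _ _) _; rewrite cabsM.
have -> : e = e / 2 + e / 2 by field.
rewrite lerD //; move: h1; rewrite ler_pdivlMr //; apply: le_trans.
by rewrite mulrC ler_wpM2l ?cabs_ge0 // lerDr.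
Qed.

Lemma continuous_at_expk k x : continuous_at (expk k) x.
Proof.
move=> e e0; set t := 2 * pi * kdot k x.
have e2 : 0 < e / 2 by rewrite divr_gt0.
have /cvgrPdist_lt/(_ _ e2) := @continuous_cos R t.
move=> /nbhs_ballP[r1 /= r10 h1].
have /cvgrPdist_lt/(_ _ e2) := @continuous_sin R t.
move=> /nbhs_ballP[r2 /= r20 h2].
set r := Num.min r1 r2; have r0 : 0 < r by rewrite lt_min r10.
(* The phase is Lipschitz in the sup distance with constant at most [A]; the summand 1 keeps [A]
   positive when k = 0. *)
set A : R := 1 + 2 * pi * \sum_(i < d) `|(k ord0 i)%:~R|.
have S0 : 0 <= \sum_(i < d) `|(k ord0 i)%:~R| :> R by exact: sumr_ge0.
have pi0 := pi_gt0 R.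
have A0 : 0 < A by rewrite ltr_pwDl // mulr_ge0 // mulr_ge0 // ltW.
exists (r / (2 * A)) => [|y yx]; first by rewrite divr_gt0 // mulr_gt0.
have D0 : 0 < r / (2 * A) by rewrite divr_gt0 // mulr_gt0.
have lt_r : `|t - 2 * pi * kdot k y| < r.
  rewrite distrC -mulrBr /kdot -sumrB normrM gtr0_norm ?mulr_gt0 //.
  apply: le_lt_trans (_ : A * (r / (2 * A)) < _); last first.
    by rewrite [ltLHS](_ : _ = r / 2) ?ltr_pdivrMr ?ltr_pMr ?ltr1n //; field;
      rewrite gt_eqF.
  move: (r / (2 * A)) D0 yx => D D0 yx.
  rewrite [leRHS](_ : _ = D + 2 * pi * ((\sum_(i < d) `|(k ord0 i)%:~R|) * D));
    last by rewrite /A; ring.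
  apply: ler_wpDl; first exact: ltW.
  rewrite ler_wpM2l //; first by rewrite mulr_ge0 // ltW.
  apply: le_trans (ler_norm_sum _ _ _) _; rewrite mulr_suml; apply: ler_sum => i _.
  by rewrite -mulrBr normrM ler_wpM2l.
have {}h1 : `|cos t - cos (2 * pi * kdot k y)| < e / 2.
  by apply: h1; apply: lt_le_trans lt_r _; rewrite ge_min lexx.
have {}h2 : `|sin t - sin (2 * pi * kdot k y)| < e / 2.
  by apply: h2; apply: lt_le_trans lt_r _; rewrite ge_min lexx orbT.
rewrite -[leLHS]/(cabs (expk k y - expk k x)).
apply: le_trans (cabs_ReIm _) _; rewrite /= -/t !(distrC _ (_ t)); lra.
Qed.

(** A trigonometric polynomial within e / 3 of the series at every point reduces the claim to the
    continuity of finitely many exponentials. *)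
Lemma continuous_at_feval (om : freq d -> R) (W : R) c x :
  (forall k, 0 < om k) ->
  (\esum_(k in [set: freq d]) ((om k ^+ 2)^-1)%:E <= W%:E)%E ->
  inH om c -> continuous_at (feval c) x.
Proof.
move=> om0 omW Hc e e0; have [s s0 cs] := (inHP _ _).1 Hc.
have e3 : 0 < e / 3 by rewrite divr_gt0.
have [S _ SP] := has_sum_tail (coef_abs_bounded om0 omW cs) e3.
have tail y : cabs (feval c y - \sum_(k <- S) c k * expk k y) <= e / 3.
  apply: SP => [k|]; first by rewrite cabs_expk.
  exact: feval_has_sum om0 _ omW _ _ Hc.
have : continuous_at (fun y => \sum_(k <- S) c k * expk k y) x.
  elim: S {SP tail} => [|k S IH].
    by move=> e' e'0; exists 1 => // y _; rewrite !big_nil subrr cabs0 ltW.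
  have := continuous_at_ZD (c k) (@continuous_at_expk k x) IH.
  by congr continuous_at; apply/funext => y; rewrite big_cons.
move=> /(_ _ e3)[delta d0 dP]; exists delta => // y /dP.
move: (tail y) (tail x); set py := \sum_(k <- S) _; set px := \sum_(k <- S) _.
move=> ty tx yx.
have -> : feval c y - feval c x = (feval c y - py) + ((py - px) - (feval c x - px)).
  by ring.
apply: le_trans (cabsD _ _) _; have := cabsD (py - px) (- (feval c x - px)).
rewrite cabsN; lra.
Qed.

End Continuity.

(** * Null sets and cubes inside the torus *)

Section NullSets.
Variables (R : realType) (d : nat).
Implicit Types (N A B : set (pt R d)) (x y p : pt R d).

Lemma null_subset A B : A `<=` B -> null_set B -> null_set A.
Proof.
move=> sub null2 e e0; have [a [b [cov vol]]] := null2 e e0.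
by exists a, b; split => // x /sub/cov.
Qed.

(** Boxes with equal corners have volume 0 as soon as there is a coordinate; in dimension 0 the
    empty product makes it 1. *)
Lemma null_set0 : (0 < d)%N -> null_set (@set0 (pt R d)).
Proof.
move=> d0 e e0; exists (fun _ _ => 0), (fun _ _ => 0); split => // m.
rewrite big1 ?ltW // => i _.
by rewrite /boxvol (bigD1 (Ordinal d0)) //= subrr maxxx mul0r.
Qed.

Lemma boxvol_ge0 (a b : pt R d) : 0 <= boxvol a b.
Proof. by apply: prodr_ge0 => i _; rewrite le_max lexx. Qed.

Lemma null_setU A B : null_set A -> null_set B -> null_set (A `|` B).
Proof.
move=> null1 null2 e e0.
have e2 : 0 < e / 2 by rewrite divr_gt0.
have [a1 [b1 [cov1 vol1]]] := null1 _ e2.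
have [a2 [b2 [cov2 vol2]]] := null2 _ e2.
(* Interleaving: even indices cover [A], odd ones [B]. The first 2 m boxes take m from each cover,
   and their volume bounds that of the first m. *)
pose mix (u v : nat -> pt R d) n := if odd n then v n./2 else u n./2.
exists (mix a1 a2), (mix b1 b2); split=> [x [/cov1|/cov2] [n _ xn]|m].
- by exists n.*2 => //; rewrite /mix odd_double doubleK.
- by exists n.*2.+1 => //; rewrite /mix /= odd_double /= uphalf_double.
pose F n := boxvol (mix a1 a2 n) (mix b1 b2 n).
have double n : \sum_(i < n.*2) F i =
    \sum_(i < n) boxvol (a1 i) (b1 i) + \sum_(i < n) boxvol (a2 i) (b2 i).
  elim: n => [|n IH]; first by rewrite !big_ord0 addr0.
  rewrite doubleS !big_ord_recr /= IH /F /mix /= odd_double /= doubleK.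
  by rewrite uphalf_double; ring.
apply: le_trans (_ : \sum_(i < m.*2) F i <= _); last first.
  by rewrite double; have := vol1 m; have := vol2 m; lra.
have le_m2 : (m <= m.*2)%N by rewrite -addnn leq_addr.
rewrite -!(big_mkord xpredT F) (big_cat_nat (leq0n m) le_m2) /=.
by rewrite lerDl sumr_ge0 // => i _; exact: boxvol_ge0.
Qed.

(** The inverse affine map turns a cover of [N] into a cover of the torus and divides each volume by
    s^d, whence the budget e s^d. *)
Lemma null_scaled_torus N (q : pt R d) (s : R) : 0 < s ->
  (forall x, torus x -> N (fun i => q i + s * x i)) -> null_set N ->
  null_set (@torus R d).
Proof.
move=> s0 sub nullN e e0.
have [a [b [cov vol]]] := nullN (e * s ^+ d) ltac:(by rewrite mulr_gt0 ?exprn_gt0).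
pose sc (u : nat -> pt R d) n : pt R d := fun i => (u n i - q i) / s.
exists (sc a), (sc b); split=> [x /sub/cov [n _ xn]|m].
  exists n => // i; rewrite /sc ler_pdivrMr // ler_pdivlMr // mulrC.
  by have := xn i; lra.
have volE n : boxvol (sc a n) (sc b n) = boxvol (a n) (b n) / s ^+ d.
  rewrite -exprVn /boxvol -[d in _ ^+ d]card_ord -prodr_const -big_split /=.
  apply: eq_bigr => i _; rewrite /sc -mulrBl opprB addrA subrK.
  by rewrite maxr_pMl ?mul0r // invr_ge0 ltW.
under eq_bigr do rewrite volE.
by rewrite -mulr_suml ler_pdivrMr ?exprn_gt0.
Qed.

(* A rescaled copy of the whole torus fits in any relative neighbourhood, so no
   volume computation is needed: if one neighbourhood were null, the torus
   would be null too, a case in which every essential supremum is -oo. *)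
Lemma nbhs_not_null p (delta : R) : ~ null_set (@torus R d) -> torus p ->
  0 < delta ->
  ~ null_set [set y | torus y /\ forall i, `|y i - p i| <= delta].
Proof.
move=> nt tp delta0; apply: contra_not nt.
set s := Num.min delta 2^-1.
have s0 : 0 < s by rewrite lt_min delta0 invr_gt0 ltr0n.
have [sd s2] : s <= delta /\ s <= 2^-1 by rewrite !ge_min !lexx orbT.
(* A cube of side at most 1/2 stays in the torus if it extends upwards from p_i when p_i <= 1/2 and
   downwards otherwise. *)
apply: (@null_scaled_torus _ (fun i => if p i <= 2^-1 then p i else p i - s) s s0).
move=> x tx; have bnd i : 0 <= s * x i <= s.
  by have /andP[x0 x1] := tx i; rewrite mulr_ge0 ?ler_piMr // ltW.
split=> i; have := bnd i; have := tp i; set z := s * x i; case: (leP (p i) 2^-1) => h.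
- by move=> /andP[p0 p1] /andP[z0 z1]; apply/andP; split; lra.
- by move=> /andP[p0 p1] /andP[z0 z1]; apply/andP; split; lra.
- by move=> _ /andP[z0 z1]; rewrite ler_norml; apply/andP; split; lra.
- by move=> _ /andP[z0 z1]; rewrite ler_norml; apply/andP; split; lra.
Qed.

End NullSets.

(** * Essential suprema and the antipodal argument *)

Section EssentialSupremum.
Variables (R : realType) (d : nat).
Local Notation C := (R[i]).
Implicit Types (x y p : pt R d) (h : pt R d -> R).
Local Notation T := (@torus R d).

Lemma ess_sup_le h (M : \bar R) : (0 < d)%N ->
  (forall x, T x -> ((h x)%:E <= M)%E) -> (ess_sup_T h <= M)%E.
Proof.
move=> d0 hM; apply: ereal_inf_lbound => /=.
have -> : [set x | T x /\ (M < (h x)%:E)%E] = set0; last exact: null_set0.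
by apply/seteqP; split => // x [tx]; rewrite ltNge hM.
Qed.

Lemma ess_sup_null h : null_set T -> ess_sup_T h = -oo%E.
Proof.
move=> nT; apply/eqP; rewrite -leeNy_eq; apply: ereal_inf_lbound.
by apply: null_subset nT => x [].
Qed.

Lemma ess_sup_lt_null h (M : \bar R) : (ess_sup_T h < M)%E ->
  null_set [set x | T x /\ (M <= (h x)%:E)%E].
Proof.
move=> /ereal_inf_lt[M' nM' ltM]; apply: null_subset nM' => x [tx Mx].
by split => //; exact: lt_le_trans Mx.
Qed.

Lemma ess_sup_ge0 h : ~ null_set T -> (forall x, 0 <= h x) ->
  (0 <= ess_sup_T h)%E.
Proof.
move=> nT h0; rewrite leNgt; apply/negP => /ess_sup_lt_null; apply: contra_not nT.
by apply: null_subset => x tx; split => //; rewrite lee_fin.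
Qed.

(* f and -f are indistinguishable for an algorithm that returns g on both. *)
Lemma antipodal_error (f g : pt R d -> C) p (e : R) : ~ null_set T -> T p ->
  continuous_at f p ->
  (ess_sup_T (fun x => cabs (f x - g x)%R) <= e%:E)%E ->
  (ess_sup_T (fun x => cabs (- f x - g x)%R) <= e%:E)%E -> cabs (f p) <= e.
Proof.
move=> nT tp cf h1 h2; rewrite leNgt; apply/negP => lt_e.
(* [e'] lies strictly between e and |f p|. Near p one has |f| >= e', and 2 |f| <= |f - g| + |- f -
   g| puts each point in one of the two null sets. *)
set e' := (cabs (f p) + e) / 2.
have lt_e' : (e%:E < e'%:E)%E by rewrite lte_fin /e'; lra.
have n1 := ess_sup_lt_null (le_lt_trans h1 lt_e').
have n2 := ess_sup_lt_null (le_lt_trans h2 lt_e').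
have [delta d0 dP] := cf ((cabs (f p) - e) / 2) ltac:(lra).
apply: (nbhs_not_null nT tp d0); apply: null_subset (null_setU n1 n2).
move=> y [ty /dP yp] /=; rewrite !lee_fin.
have fy : e' <= cabs (f y).
  have := cabsD (f p - f y) (f y); rewrite subrK cabsB /e'; lra.
have : 2 * cabs (f y) <= cabs (f y - g y) + cabs (- f y - g y).
  have := cabsD (f y - g y) (- (- f y - g y)).
  have -> : f y - g y - (- f y - g y) = 2%:R * f y by ring.
  by rewrite cabsN cabsM -[2%:R](rmorph_nat (real_complex R)) cabs_real normr_nat.
by case: (leP e' (cabs (f y - g y))) => hy ?; [left|right; split => //; lra].
Qed.

End EssentialSupremum.

(** * Sampling against arbitrary linear information for fixed n *)

Section SamplingVersusArbitraryInformation.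
Variables (R : realType) (d : nat) (om : freq d -> R) (W : R).
Local Notation C := (R[i]).
Hypothesis d0 : (0 < d)%N.
Hypothesis om0 : forall k, 0 < om k.
Hypothesis omW : (\esum_(k in [set: freq d]) ((om k ^+ 2)^-1)%:E <= W%:E)%E.
Local Notation T := (@torus R d).

Lemma unit_ball0 : unit_ball om (fun=> 0).
Proof.
apply/hnorm2_leP => S _; rewrite big1 // => k _.
by rewrite cabs0 expr0n mul0r.
Qed.

Lemma Lam_all_bounded L : Lam_all om L ->
  exists B : R, forall c, unit_ball om c -> cabs (L c) <= B.
Proof.
move=> [_ [M LM]]; exists `|M| => c Bc.
rewrite -ler_sqr ?nnegrE ?cabs_ge0 // real_normK ?num_real // -lee_fin.
apply: le_trans (LM c (unit_ball_inH Bc)) _.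
by rewrite -[leRHS]mule1 lee_wpmul2l // lee_fin sqr_ge0.
Qed.

(** Both [h] and its negative give zero information, hence the same output, so [antipodal_error]
    applies; continuity turns an essential bound into one at every point. *)
Lemma kernel_le_alg_err n (L : 'I_n -> fnl R d) phi h p (e : R) :
  (forall i, linear_on_H om (L i)) -> ~ null_set T -> T p ->
  unit_ball om h -> (forall i, L i h = 0) ->
  (alg_err om L phi <= e%:E)%E -> cabs (feval h p) <= e.
Proof.
move=> linL nT tp Bh Lh0 err_e; have Hh := unit_ball_inH Bh.
have Bh' : unit_ball om (fun k => -1 * h k).
  have := @hnorm2Z R d om (-1) h 1 ler01.
  by rewrite cabsN cabs1 mul1r expr1n => /(_ Bh).
apply: (antipodal_error (g := phi (fun=> 0)) nT tp).
- exact: continuous_at_feval om0 omW Hh.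
- apply: le_trans err_e; apply: ereal_sup_ubound; exists h => //.
  by congr (Linf_dist h (phi _)); apply/funext => i; rewrite Lh0.
- apply: le_trans err_e; apply: ereal_sup_ubound.
  exists (fun k => -1 * h k) => //.
  rewrite [X in phi X](_ : _ = fun=> 0); last first.
    by apply/funext => i; rewrite (linear_on_HZ (-1) (linL i) Hh) Lh0 mulr0.
  congr ess_sup_T; apply/funext => x; congr (cabs (_ - _)).
  by rewrite (linear_on_HZ (-1) (feval_linear om0 omW x) Hh) mulN1r.
Qed.

Lemma sampling_alg n (L : 'I_n -> fnl R d) phi : (forall i, Lam_all om (L i)) ->
  exists (L' : 'I_n -> fnl R d) phi', (forall i, Lam_std (L' i)) /\
    (alg_err om L' phi' <= ((1 + 2 * n%:R) ^+ 2)%:E * alg_err om L phi)%E.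
Proof.
move=> LamL; have linL i : linear_on_H om (L i) by have [] := LamL i.
have T0 : T (fun=> 0) by move=> i; rewrite lexx ler01.
have Q0 : 0 < 1 + 2 * n%:R :> R by rewrite ltr_pwDl // mulr_ge0.
set Q := 1 + 2 * n%:R in Q0 *.
(* On a null torus every essential supremum is [-oo], so any sampling algorithm does. *)
have [nT|nT] := pselect (null_set T).
  exists (fun _ c => feval c (fun=> 0)), (fun _ _ => 0); split.
    by move=> i; exists (fun=> 0).
  apply: ge_ereal_sup => _ [c _ <-]; rewrite /Linf_dist ess_sup_null //.
  exact: leNye.
have [B LB] : exists B : R, forall c i, unit_ball om c -> cabs (L i c) <= B.
  have [M MP] := choice (fun i => Lam_all_bounded (LamL i)).
  exists (\sum_i `|M i|) => c i Bc; apply: le_trans (MP i c Bc) _.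
  by rewrite (bigD1 i) //= (le_trans (ler_norm _)) // lerDl sumr_ge0.
(* First use: the points are elements of the unit ball, the coordinates their values under the
   [L i]. *)
have [g [Bg gP]] := near_fekete unit_ball0 LB.
have fB x j : T x -> cabs (feval (g j) x) <= Num.sqrt (1 * W).
  by move=> _; exact: (feval_le om0 omW (N := 1) x (Bg j)).
(* Second use: the points lie in the torus, the coordinates are the values of the [g j] there. *)
have [p [Tp pP]] := near_fekete T0 fB.
have ex x : exists l : 'I_n -> C, T x -> (forall j, cabs (l j) <= 2) /\
    forall i, feval (g i) x = \sum_j l j * feval (g i) (p j).
  have [Tx|nTx] := pselect (T x); last by exists (fun=> 0).
  by have [l lP] := pP x Tx; exists l.
have [ell ellP] := choice ex.
exists (fun i c => feval c (p i)), (fun y x => \sum_i ell x i * y i).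
split=> [i|]; first by exists (p i).
(* The value [-oo] would bound the zero function, which has zero information, by -1. *)
case E : (alg_err om L phi) => [e||]; first last.
- have errN1 : (alg_err om L phi <= (-1)%:E)%E by rewrite E leNye.
  have := kernel_le_alg_err linL nT T0 unit_ball0
    (fun i => linear_on_H0 (linL i)) errN1.
  by move=> /(le_trans (cabs_ge0 _)); rewrite oppr_ge0 ler10.
- by rewrite mulry gtr0_sg ?exprn_gt0 // mul1e leey.
apply: ge_ereal_sup => _ [c Bc <-]; apply: ess_sup_le => // x Tx.
rewrite lee_fin; have [l [l2 Ll]] := gP c Bc.
have [hQ hL] := residual (index_enum 'I_n) Bc Bg l2.
set h := fun k => _ in hQ hL.
have sz : size (index_enum 'I_n) = n by rewrite -sum1_size big_const_ord iter_addn_0 mul1n.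
rewrite sz -/Q in hQ.
have Hh : inH om h by apply/inHP; exists Q => //; exact: ltW.
(* Dividing [h] by [Q] gives an element of the unit ball in the kernel of the information. *)
have h_le y : T y -> cabs (feval h y) <= Q * e.
  move=> Ty; rewrite mulrC -ler_pdivrMr // mulrC.
  have := kernel_le_alg_err (phi := phi) (e := e)
    (h := fun k => (Q^-1%:C)%C * h k) linL nT Ty.
  rewrite (linear_on_HZ _ (feval_linear om0 omW y) Hh) cabsM cabs_real.
  rewrite gtr0_norm ?invr_gt0 //; apply; last by rewrite E.
    have := hnorm2Z (Q^-1%:C)%C (ltW Q0) hQ.
    by rewrite cabs_real gtr0_norm ?invr_gt0 // mulVf ?gt_eqF // expr1n.
  move=> i; rewrite (linear_on_HZ _ (linL i) Hh) hL // Ll.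
  by rewrite subrr mulr0.
have dec y : feval c y = feval h y + \sum_i l i * feval (g i) y.
  by rewrite (hL _ (feval_linear om0 omW y)) subrK.
(* The interpolation is exact on every [g i], so only the remainder [h] contributes to the error. *)
have -> : feval c x - \sum_i ell x i * feval c (p i) =
    feval h x - \sum_i ell x i * feval h (p i).
  rewrite [in LHS]dec; under [X in _ - X]eq_bigr do rewrite dec mulrDr.
  rewrite big_split /= opprD addrACA [X in _ + X](_ : _ = 0) ?addr0 //.
  apply/eqP; rewrite subr_eq0; apply/eqP.
  under [RHS]eq_bigr do rewrite mulr_sumr.
  rewrite exchange_big /=; apply: eq_bigr => i _.
  rewrite (ellP x Tx).2 mulr_sumr; apply: eq_bigr => j _; ring.
apply: le_trans (cabsD _ _) _; rewrite cabsN.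
have e0 : 0 <= Q * e by apply: le_trans (h_le _ T0); exact: cabs_ge0.
(* The remainder counts once at x and with weight at most 2 at each of the n points: (1 + 2 n) Q e =
   Q^2 e. *)
apply: le_trans (_ : Q * e + \sum_(i < n) 2 * (Q * e) <= _).
  rewrite lerD ?h_le // (le_trans (cabs_sum _ _ _)) // ler_sum // => i _.
  by rewrite cabsM ler_pM ?cabs_ge0 ?h_le // (ellP x Tx).1.
rewrite sumr_const card_ord -mulr_natl /Q le_eqVlt; apply/orP; left; apply/eqP.
ring.
Qed.

Lemma nth_err_std_le n : (nth_err om (@Lam_std R d) n <=
  ((1 + 2 * n%:R) ^+ 2)%:E * nth_err om (Lam_all om) n)%E.
Proof.
(* For n = 0 both errors are the initial error, and the factor is 1. *)
rewrite /nth_err; case: eqP => [->|_]; first by rewrite mulr0 addr0 expr1n mul1e.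
have Q0 : 0 < (1 + 2 * n%:R) ^+ 2 :> R by rewrite exprn_gt0 // ltr_pwDl // mulr_ge0.
rewrite -lee_pdivrMl //; apply: le_ereal_inf_tmp => _ [L [phi [LamL ->]]].
rewrite lee_pdivrMl //; have [L' [phi' [LamL' le_err]]] := sampling_alg phi LamL.
by apply: le_trans le_err; apply: ereal_inf_lbound; exists L', phi'.
Qed.

Lemma nth_err_all_le n :
  (nth_err om (Lam_all om) n <= nth_err om (@Lam_std R d) n)%E.
Proof.
rewrite /nth_err; case: eqP => // _; apply: ereal_inf_le_tmp.
move=> _ [L [phi [LamL ->]]]; exists L, phi; split=> // i.
exact: Lam_std_sub_Lam_all om0 _ omW _ (LamL i).
Qed.

(** The value [-oo] accounts for a null torus; otherwise the zero function already contributes a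
    nonnegative term. *)
Lemma init_err_ge0 : init_err om = -oo%E \/ (0 <= init_err om)%E.
Proof.
have [nT|nT] := pselect (null_set T); [left|right].
  apply/eqP; rewrite -leeNy_eq; apply: ge_ereal_sup => _ [c _ <-].
  by rewrite ess_sup_null.
apply: (@le_trans _ _ (ess_sup_T (fun x : pt R d => cabs (feval (fun=> 0) x)))).
  by apply: ess_sup_ge0 => // x; exact: cabs_ge0.
by apply: ereal_sup_ubound; exists (fun=> 0) => //; exact: unit_ball0.
Qed.

End SamplingVersusArbitraryInformation.

(** * Information complexity *)

Section InformationComplexity.
Variables (R : realType) (d : nat) (om : freq d -> R) (W : R) (cr : criterion).
Hypothesis d0 : (0 < d)%N.
Hypothesis om0 : forall k, 0 < om k.
Hypothesis omW : (\esum_(k in [set: freq d]) ((om k ^+ 2)^-1)%:E <= W%:E)%E.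

Lemma lnE_ge0 (x : \bar R) : (0 <= lnE x)%E.
Proof. by case: x => //= r; rewrite lee_fin ln_ge0 // le_max lexx. Qed.

Lemma lnE_le (x y : \bar R) : (x <= y)%E -> (lnE x <= lnE y)%E.
Proof.
case: y => [y||]; last 2 first.
- by move=> _; exact: leey.
- by rewrite leeNy_eq => /eqP ->.
case: x => [x||] //; last by move=> _; exact: lnE_ge0.
have gt0 (z : R) : 0 < Num.max 1 z by rewrite lt_max ltr01.
by rewrite !lee_fin => xy; rewrite ler_ln ?posrE // le_max2.
Qed.

(** A nonempty set of naturals has a minimum, so the infimum defining [nstar] is attained; an empty
    set would make it [+oo]. *)
Lemma lnE_nstar_lt Lam (eps B : R) : (lnE (nstar om cr Lam eps) < B%:E)%E ->
  exists2 m, (nth_err om Lam m <= eps%:E * CRI om cr)%E &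
    ln (Num.max 1 m%:R) < B.
Proof.
set P := fun m => (nth_err om Lam m <= eps%:E * CRI om cr)%E.
have [exP|nP] := pselect (exists m, P m); last first.
  suff -> : nstar om cr Lam eps = +oo%E by [].
  apply/eqP; rewrite -leye_eq; apply: le_ereal_inf_tmp => _ [m Pm <-].
  by case: nP; exists m.
have [m Pm minm] : exists2 m, P m & forall k, P k -> (m <= k)%N.
  by case: (ex_minnP exP) => m Pm minm; exists m.
move=> lt_B; exists m => //.
rewrite -lte_fin; apply: le_lt_trans lt_B; rewrite -[leLHS]/(lnE m%:R%:E).
apply: lnE_le; apply: le_ereal_inf_tmp => _ [k Pk <-].
by rewrite lee_fin ler_nat minm.
Qed.

Lemma nstar_all_le eps :
  (nstar om cr (Lam_all om) eps <= nstar om cr (@Lam_std R d) eps)%E.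
Proof.
apply: ereal_inf_le_tmp => _ [m Pm <-]; exists m => //.
exact: le_trans (nth_err_all_le om0 omW m) Pm.
Qed.

(** Sampling keeps the number m and pays with accuracy: the loss (1 + 2 m)^2 must fit between [eps']
    and [eps]. *)
Lemma nstar_std_le (eps eps' : R) m : 0 < eps' ->
  (1 + 2 * m%:R) ^+ 2 * eps' <= eps ->
  (nth_err om (Lam_all om) m <= eps'%:E * CRI om cr)%E ->
  (nstar om cr (@Lam_std R d) eps <= m%:R%:E)%E.
Proof.
move=> eps'0 le_eps Pm; apply: ereal_inf_lbound; exists m => //=.
have Q0 : 0 < (1 + 2 * m%:R) ^+ 2 :> R by rewrite exprn_gt0 // ltr_pwDl // mulr_ge0.
have eps0 : 0 < eps by apply: lt_le_trans le_eps; rewrite mulr_gt0.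
apply: le_trans (nth_err_std_le d0 om0 omW m) _.
apply: le_trans (lee_wpmul2l _ Pm) _; first by rewrite lee_fin ltW.
rewrite muleA -EFinM.
(* In the case [-oo] both products with a positive number are [-oo]; otherwise multiplication is
   monotone. *)
have [->|CRI0] : CRI om cr = -oo%E \/ (0 <= CRI om cr)%E.
- by case: cr => /=; [right; exact: lee01|exact: init_err_ge0].
- by rewrite !gt0_muleNy ?lte_fin ?mulr_gt0.
- by rewrite lee_wpmul2r // lee_fin.
Qed.

End InformationComplexity.

(** * Growth rates and the error budget *)

Section RealBounds.
Variable R : realType.
Implicit Types (a x y : R).

Lemma ratio_lt (x : \bar R) (g eta : R) : 0 < g -> (0 <= x)%E ->
  (`|x * (g^-1)%:E| < eta%:E)%E = (x < (eta * g)%:E)%E.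
Proof.
move=> g0 x0; rewrite gee0_abs; last by rewrite mule_ge0 // lee_fin invr_ge0 ltW.
by rewrite lte_pdivrMr // EFinM.
Qed.

Lemma powR_le_id a x : 1 <= x -> a <= 1 -> x `^ a <= x.
Proof.
by move=> x1 a1; rewrite -{2}(powRr1 (le_trans ler01 x1)) ler_powR.
Qed.

Lemma powR_ge1 a x : 1 <= x -> 0 <= a -> 1 <= x `^ a.
Proof. by move=> x1 a0; rewrite -(powRr0 x) ler_powR. Qed.

(** With y the larger term, (x + y)^a <= (2 y)^a <= 2 y^a, as 2^a <= 2. *)
Lemma powRD_le a x y : 0 < a <= 1 -> 0 <= x -> 0 <= y ->
  (x + y) `^ a <= 2 * (x `^ a + y `^ a).
Proof.
move=> /andP[a0 a1].
wlog xy : x y / x <= y => [hw x0 y0|x0 y0].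
  by have [xy|/ltW yx] := leP x y; [|rewrite addrC [in leRHS]addrC]; exact: hw.
apply: (@le_trans _ _ ((2 * y) `^ a)).
  by rewrite ge0_ler_powR ?nnegrE ?(ltW a0) ?addr_ge0 ?mulr_ge0 //; lra.
rewrite powRM //; apply: ler_pM; rewrite ?powR_ge0 ?lerDr ?powR_ge0 //.
by apply: powR_le_id => //; rewrite ler1n.
Qed.

(** [G] is the denominator at the accuracy eps' with ln (1 / eps') = 2 l + D + 9. Capping the
    exponent at 1 makes it at most linear; the constant 20 is the 2 of [powRD_le] times the 10 of 10
    (1 + l), and leaves room for 3 D. *)
Lemma rate_comparison alpha (l D : R) : 0 < alpha -> 0 <= l -> 1 <= D ->
  let a := Num.min alpha 1 in
  let G := (1 + (2 * l + D + 9)) `^ a + D in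
  G <= 1 + (2 * l + D + 9) + D /\ G <= 20 * ((1 + l) `^ alpha + D).
Proof.
move=> alpha0 l0 D1 a G.
have a0 : 0 < a by rewrite lt_min alpha0 ltr01.
have a1 : a <= 1 by rewrite ge_min lexx orbT.
have aa : a <= alpha by rewrite ge_min lexx.
split; first by rewrite lerD2r powR_le_id //; lra.
have h1 : (1 + (2 * l + D + 9)) `^ a <= (10 * (1 + l) + D) `^ a.
  by rewrite ge0_ler_powR ?nnegrE ?(ltW a0) //; lra.
have h2 : (10 * (1 + l) + D) `^ a <= 2 * ((10 * (1 + l)) `^ a + D `^ a).
  by apply: powRD_le; rewrite ?a0 //; lra.
have h3 : (10 * (1 + l)) `^ a <= 10 * (1 + l) `^ alpha.
  rewrite powRM //; last by lra.
  apply: ler_pM; rewrite ?powR_ge0 //; last by rewrite ler_powR //; lra.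
  by apply: powR_le_id => //; rewrite ler1n.
have h4 : D `^ a <= D by exact: powR_le_id.
have h5 : 0 <= (1 + l) `^ alpha by exact: powR_ge0.
rewrite /G; lra.
Qed.

(** With M = max (1, m), 1 + 2 m <= 3 M <= e^2 M, so the squared factor is at most exp (4 + 2 u) <=
    exp (l + D + 9); hence 9 = 4 + 5. *)
Lemma error_budget (l D u : R) m : u <= (1 + (2 * l + D + 9) + D) / 4 ->
  ln (Num.max 1 m%:R) <= u ->
  (1 + 2 * m%:R) ^+ 2 * expR (- (2 * l + D + 9)) <= expR (- l).
Proof.
move=> u_le m_u; set M := Num.max 1 m%:R in m_u.
have M0 : 0 < M by rewrite lt_max ltr01.
have M1 : 1 <= M by rewrite le_max lexx.
have mM : m%:R <= M by rewrite le_max lexx orbT.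
have le_exp : 1 + 2 * m%:R <= expR (2 + ln M).
  rewrite expRD lnK ?posrE //.
  have /(ler_wpM2r (ltW M0)) : 1 + 2 <= expR 2 :> R by exact: expR_ge1Dx.
  by apply: le_trans; lra.
apply: (@le_trans _ _ (expR (2 + ln M) ^+ 2 * expR (- (2 * l + D + 9)))).
  have m0 : 0 <= 1 + 2 * m%:R :> R by rewrite addr_ge0 ?mulr_ge0.
  by rewrite ler_wpM2r ?expR_ge0 // ler_sqr ?nnegrE ?expR_ge0.
by rewrite expr2 -!expRD ler_expR; lra.
Qed.

End RealBounds.

(** * Equivalence of the two tractability notions *)

Theorem theorem4p5 (R : realType) (om : forall d : nat, freq d -> R)
    (cr : criterion) :
  (forall d : nat, (0 < d)%N -> forall k : freq d, 0 < om d k) ->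
  (forall d : nat, (0 < d)%N ->
     (\esum_(k in [set: freq d]) (((om d k) ^+ 2)^-1)%:E < +oo)%E) ->
  (EXP_UWT om cr (fun d => Lam_all (om d)) <-> EXP_UWT om cr (@Lam_std R)).
Proof.
move=> om0 omfin.
have omW d : (0 < d)%N -> exists W : R,
    (\esum_(k in [set: freq d]) (((om d k) ^+ 2)^-1)%:E <= W%:E)%E.
  move=> d0; exists (fine (\esum_(k in [set: freq d]) (((om d k) ^+ 2)^-1)%:E)%E).
  rewrite fineK // ge0_fin_numE ?omfin //; apply: esum_ge0 => k _.
  by rewrite lee_fin invr_ge0 sqr_ge0.
have rate0 (alpha beta l : R) (d : nat) : 0 < 1 + l -> 0 < (1 + l) `^ alpha + d%:R `^ beta.
  by move=> l0; rewrite ltr_pwDl ?powR_gt0 ?powR_ge0.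
have ln_inv_gt0 (eps : R) : 0 < eps < 1 -> 0 < ln eps^-1.
  by move=> /andP[e0 e1]; rewrite ln_gt0 // invf_gt1.
(* From sampling to all functionals: inclusion of the classes, with the same [K]. *)
split=> uwt alpha beta alpha0 beta0 eta eta0; last first.
  have [K KP] := uwt alpha beta alpha0 beta0 eta eta0.
  exists K => d eps d0 eps01 ltK; have [W dW] := omW d d0.
  have g0 : 0 < (1 + ln eps^-1) `^ alpha + d%:R `^ beta.
    by apply: rate0; rewrite addr_gt0 // ln_inv_gt0.
  have := KP d eps d0 eps01 ltK; rewrite !ratio_lt ?lnE_ge0 //.
  by apply: le_lt_trans; apply: lnE_le; exact: nstar_all_le (om0 d d0) dW _.
set a := Num.min alpha 1; have a0 : 0 < a by rewrite lt_min alpha0 ltr01.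
(* 1/4 meets the hypothesis of [error_budget], and 20 undoes the constant of [rate_comparison]. *)
set eta' := Num.min (1 / 4) (eta / 20).
have eta'0 : 0 < eta' by rewrite lt_min !divr_gt0.
have [eta'4 eta'20] : eta' <= 1 / 4 /\ eta' <= eta / 20.
  by rewrite !ge_min !lexx orbT.
have [K KP] := uwt a beta a0 beta0 eta' eta'0.
exists K => d eps d0 eps01 ltK; have [W dW] := omW d d0.
have /andP[eps0 eps1] := eps01.
have l0 := ln_inv_gt0 eps eps01; set l := ln eps^-1 in l0 *.
set D : R := d%:R `^ beta.
have D1 : 1 <= D by rewrite powR_ge1 ?ler1n // ltW.
set G := (1 + (2 * l + D + 9)) `^ a + D.
have [G_le1 G_le2] : G <= 1 + (2 * l + D + 9) + D /\
    G <= 20 * ((1 + l) `^ alpha + D) := rate_comparison alpha0 (ltW l0) D1.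
have G0 : 0 < G by apply: rate0; lra.
have g0 : 0 < (1 + l) `^ alpha + D by apply: rate0; rewrite addr_gt0.
have epsE : eps = expR (- l) by rewrite /l lnV ?posrE // opprK lnK ?posrE //.
set eps' := expR (- (2 * l + D + 9)).
have eps'E : ln eps'^-1 = 2 * l + D + 9 by rewrite /eps' -expRN opprK expRK.
have eps'0 : 0 < eps' := expR_gt0 _.
have eps'1 : eps' < 1 by rewrite /eps' expR_lt1; lra.
(* As eps' <= eps, being beyond the threshold [K] at eps implies the same at eps'. *)
have ltK' : K < eps'^-1 + d%:R.
  apply: lt_le_trans ltK _; rewrite lerD2r lef_pV2 ?posrE //.
  by rewrite epsE /eps' ler_expR; lra.
have := KP d eps' d0 _ ltK'; rewrite eps'0 eps'1 => /(_ isT).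
rewrite eps'E !ratio_lt ?lnE_ge0 //.
move=> /lnE_nstar_lt[m Pm lt_m].
have std_le : (nstar (om d) cr (@Lam_std R d) eps <= m%:R%:E)%E.
  apply: (nstar_std_le d0 (om0 d d0) dW eps'0 _ Pm); rewrite epsE.
  apply: error_budget (ltW lt_m).
  apply: (@le_trans _ _ (1 / 4 * G)); first by rewrite ler_wpM2r // ltW.
  by rewrite mulrC mul1r ler_wpM2r // invr_ge0.
apply: le_lt_trans (lnE_le std_le) _; rewrite lte_fin.
apply: lt_le_trans lt_m _.
apply: (@le_trans _ _ (eta / 20 * G)); first by rewrite ler_wpM2r // ltW.
rewrite -mulrA ler_wpM2l ?(ltW eta0) //; lra.
Qed.
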